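(* Let $u_0>0$, let $x^0=X$ (i.e. $x^0_i=X_i$), and let $x^n=(x^n_0,\dots,x^n_M)\in\mathcal Q$, $n=1,\dots,N$, be the numerical trajectories given by the fully discrete scheme (S) of the context. Define the numerical density $\{u_i^n\}_{i=0}^M$, $n=1,\dots,N$, by $$u_i^n=\frac{u_0(X_i)}{(x^n_{i+1}-x^n_{i-1})/(2h)},\ 1\le i\le M-1,\qquad u^n_0=\frac{u_0(X_0)}{(x^n_1-x^n_0)/h},\qquad u^n_M=\frac{u_0(X_M)}{(x^n_M-x^n_{M-1})/h}.$$ Then the numerical density conserves mass and is positive: for every $n=1,\dots,N$, the total discrete mass satisfies $\sum_{i=0}^M m_i^n=\sum_{i=0}^M m_i^0$, and $u_i^n>0$ for all $0\le i\le M$. Here $$m_i^0=h\,u_0(X_i)\ (1\le i\le M-1),\quad m_0^0=\tfrac h2u_0(X_0),\quad m_M^0=\tfrac h2u_0(X_M),$$ $$m_i^n=\frac{x^n_{i+1}-x^n_{i-1}}2u_i^n\ (1\le i\le M-1),\quad m_0^n=\frac{x_1^n-x_0^n}2u_0^n,\quad m_M^n=\frac{x_M^n-x_{M-1}^n}2u_M^n .$$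
   Context: Let $\Omega\subset\mathbb{R}$ be a bounded interval with left endpoint $X_0$, $M\in\mathbb{N}^+$, $h=|\Omega|/M$, $X_r=X_0+rh$ for integer or half-integer $r$, and $\tau=T/N$ the time step. $\mathcal E_M$ and $\mathcal C_M$ denote the spaces of grid functions on $\{X_i: 0\le i\le M\}$ and $\{X_{i-1/2}:1\le i\le M\}$, respectively. Difference operators: $(D_hl)_{i-1/2}=(l_i-l_{i-1})/h$, $1\le i\le M$; $(d_h\phi)_i=(\phi_{i+1/2}-\phi_{i-1/2})/h$, $1\le i\le M-1$; $(\widetilde D_hl)_i=(l_{i+1}-l_{i-1})/(2h)$ for $1\le i\le M-1$, $(\widetilde D_hl)_0=(l_1-l_0)/h$, $(\widetilde D_hl)_M=(l_M-l_{M-1})/h$. Inner product: $\langle l,g\rangle_{\mathcal E}=h\big(\frac12l_0g_0+\sum_{i=1}^{M-1}l_ig_i+\frac12l_Mg_M\big)$. The admissible set is $\mathcal Q=\{l\in\mathcal E_M: l_{i-1}<l_i,\ 1\le i\le M;\ l_0=X_0,\ l_M=X_M\}$. Data: $u_0$ is the initial density on $\overline\Omega$; $H:[0,\infty)\to\mathbb{R}$ with $H''>0$; $f:[0,\infty)\to[0,\infty)$ increasing and differentiable with $f(0)=0$, $f'(0)\ne0$; $V=V_c-V_e$ and $W=W_c-W_e$ with $V_c,V_e,W_c,W_e$ convex (and $W$ even, Lipschitz). Fully discrete scheme (S): given $x^n\in\mathcal Q$, find $x^{n+1}\in\mathcal Q$ (so $x_0^{n+1}=X_0$, $x_M^{n+1}=X_M$)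 such that for $1\le i\le M-1$ $$\frac{u_{0,i}^2}{(\widetilde D_hx^n)_i}\cdot\frac1{f\big(\frac{u_{0,i}}{(\widetilde D_hx^n)_i}\big)}\cdot\frac{x_i^{n+1}-x_i^n}{\tau}=-d_h\Big[\frac{u_0}{D_hx^{n+1}}H'\Big(\frac{u_0}{D_hx^{n+1}}\Big)-H\Big(\frac{u_0}{D_hx^{n+1}}\Big)\Big]_i-u_{0,i}V_c'(x_i^{n+1})+u_{0,i}V_e'(x_i^n)-u_{0,i}\hat{\mathcal S}_{c,i}^{n+1}+u_{0,i}\hat{\mathcal S}_{e,i}^n,$$ where $u_{0,i}=u_0(X_i)$, the bracket is evaluated at half points with $u_0(X_{i\pm1/2})$, and $\hat{\mathcal S}_{c,i}^{n+1}=\langle W_c'(x_i^{n+1}-x^{n+1}),u_0\rangle_{\mathcal E}$, $\hat{\mathcal S}_{e,i}^{n}=\langle W_e'(x_i^{n}-x^{n}),u_0\rangle_{\mathcal E}$ (the inner product taken over the grid variable of the second occurrence of $x$). *)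

(* Defs.v *)
From HB Require Import structures.
From mathcomp Require Import all_boot all_order all_algebra.
From mathcomp Require Import all_classical all_reals all_analysis.
Import Order.TTheory GRing.Theory Num.Theory.
Import numFieldNormedType.Exports.

Set Implicit Arguments.
Unset Strict Implicit.
Unset Printing Implicit Defensive.

Local Open Scope classical_set_scope.
Local Open Scope ring_scope.

(* An element of [nodal R M] gives the values at X_0, ..., X_M; an element of
   [half R M] gives the values at the half points, the index j : 'I_M standing
   for the point X_{j + 1/2} (so the index i - 1 stands for X_{i - 1/2}).
   The nodes on the left and on the right of the half point j are
   [lift ord_max j] (of value j) and [lift ord0 j] (of value j + 1). *)
Definition nodal (R : realType) (M : nat) : Type := 'I_M.+1 -> R.
Definition half (R : realType) (M : nat) : Type := 'I_M -> R.

Definition mesh (R : realType) (a b : R) (M : nat) : R := (b - a) / M%:R.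

(* X_r, for integer or half-integer r *)
Definition gridpt (R : realType) (a b : R) (M : nat) (r : R) : R :=
  a + r * mesh a b M.

Definition node (R : realType) (a b : R) (M : nat) : nodal R M :=
  fun i => gridpt a b M i%:R.
Arguments node {R} a b M _.

Definition midpt (R : realType) (a b : R) (M : nat) : half R M :=
  fun j => gridpt a b M (j%:R + 2^-1).
Arguments midpt {R} a b M _.

Definition interior (M : nat) (i : 'I_M.+1) : bool := (0 < i < M)%N.

Definition next (M : nat) (i : 'I_M.+1) : 'I_M.+1 := inord i.+1.
Definition prev (M : nat) (i : 'I_M.+1) : 'I_M.+1 := inord i.-1.

Definition Dh (R : realType) (M : nat) (h : R) (l : nodal R M) : half R M :=
  fun j => (l (lift ord0 j) - l (lift ord_max j)) / h.

(* [unlift ord_max i] is the half point i + 1/2 (None for i = M) and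
   [unlift ord0 i] is the half point i - 1/2 (None for i = 0); the default
   value 0 is never used at an interior node. *)
Definition dh (R : realType) (M : nat) (h : R) (phi : half R M) : nodal R M :=
  fun i => (oapp phi 0 (unlift ord_max i) - oapp phi 0 (unlift ord0 i)) / h.

Definition tDh (R : realType) (M : nat) (h : R) (l : nodal R M) : nodal R M :=
  fun i =>
    if i == 0%N :> nat then (l (next i) - l i) / h
    else if i == M :> nat then (l i - l (prev i)) / h
    else (l (next i) - l (prev i)) / (2 * h).

Definition inner (R : realType) (M : nat) (h : R) (l g : nodal R M) : R :=
  h * (2^-1 * l ord0 * g ord0 + \sum_(i < M.+1 | interior i) l i * g i
       + 2^-1 * l ord_max * g ord_max).

Definition admissible (R : realType) (a b : R) (M : nat) (l : nodal R M) :=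
  [/\ forall j : 'I_M, l (lift ord_max j) < l (lift ord0 j),
      l ord0 = node a b M ord0
    & l ord_max = node a b M ord_max].

(* One step of the scheme, from x = x^n to y = x^{n+1}.  The derivative derive1
   is total; at points where the corresponding function is not differentiable
   its value is arbitrary. *)
Definition scheme_step (R : realType) (a b : R) (M : nat) (tau : R)
    (u0 H f Vc Ve Wc We : R -> R) (x y : nodal R M) : Prop :=
  let h := mesh a b M in
  let u0n : nodal R M := fun i => u0 (node a b M i) in
  let ratio : half R M := fun j => u0 (midpt a b M j) / Dh h y j in
  let Sc : nodal R M := fun i =>
    inner h (fun k => derive1 Wc (y i - y k)) u0n in
  let Se : nodal R M := fun i =>
    inner h (fun k => derive1 We (x i - x k)) u0n in
  forall i : 'I_M.+1, interior i ->
    u0n i ^+ 2 / tDh h x i * (1 / f (u0n i / tDh h x i)) * ((y i - x i) / tau)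
    = - dh h (fun j => ratio j * derive1 H (ratio j) - H (ratio j)) i
      - u0n i * derive1 Vc (y i) + u0n i * derive1 Ve (x i)
      - u0n i * Sc i + u0n i * Se i.

Definition density (R : realType) (a b : R) (M : nat) (u0 : R -> R)
    (l : nodal R M) : nodal R M :=
  fun i => u0 (node a b M i) / tDh (mesh a b M) l i.

Definition mass0 (R : realType) (a b : R) (M : nat) (u0 : R -> R) :
    nodal R M :=
  fun i => if interior i then mesh a b M * u0 (node a b M i)
           else mesh a b M / 2 * u0 (node a b M i).

Definition mass (R : realType) (a b : R) (M : nat) (u0 : R -> R)
    (l : nodal R M) : nodal R M :=
  fun i =>
    if i == 0%N :> nat then (l (next i) - l i) / 2 * density a b u0 l i
    else if i == M :> nat then (l i - l (prev i)) / 2 * density a b u0 l i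
    else (l (next i) - l (prev i)) / 2 * density a b u0 l i.

Definition convex_on_line (R : realType) (g : R -> R) : Prop :=
  convex_function [set: convex_lmodType R^o] g.

(* H'' > 0.  Only the open half-line is used: the typical s * ln s has no
   derivative at 0. *)
Definition second_derivative_pos (R : realType) (H : R -> R) : Prop :=
  forall s, 0 < s ->
    [/\ derivable H s 1, derivable (derive1 H) s 1 & 0 < derive1n 2 H s].

(* The function f : [0, oo[ -> [0, oo[ is given by a function on R of which
   only the restriction to [0, oo[ matters; its derivative at 0 is
   one-sided. *)
Definition mobility (R : realType) (f : R -> R) : Prop :=
  [/\ forall s, 0 <= s -> 0 <= f s,
      forall s t, 0 <= s -> s <= t -> f s <= f t,
      forall s, 0 < s -> derivable f s 1,
      f 0 = 0
    & exists2 d : R, d != 0 & (f s - f 0) / s @[s --> 0^'+] --> d].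

(* Main.v *)
(* The difference quotient that divides u_0 in the density at a node is the
   increment that multiplies it in the mass, up to the factor h (h/2 at the two
   endpoints); hence the mass at each node, and not only the total, is
   conserved as soon as these quotients are nonzero.  They are positive because
   an admissible grid is strictly increasing. *)

Require Import Defs.
From HB Require Import structures.
From mathcomp Require Import all_boot all_order all_algebra.
From mathcomp Require Import all_classical all_reals all_analysis.
From mathcomp Require Import ring.
Import Order.TTheory GRing.Theory Num.Theory.
Import numFieldNormedType.Exports.

Local Open Scope ring_scope.

Lemma mesh_gt0 {R : realType} {a b : R} {M : nat} :
  a < b -> (0 < M)%N -> 0 < mesh a b M.
Proof. by move=> ab M_gt0; rewrite divr_gt0 ?subr_gt0 ?ltr0n. Qed.

(** Positivity of [u0] is assumed on [[a, b]] only, so the nodes must be located there; the upper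
    bound comes from [i / M <= 1]. *)
Lemma node_itv {R : realType} {a b : R} {M : nat} {i : 'I_M.+1} :
  a <= b -> (0 < M)%N -> a <= node a b M i <= b.
Proof.
move=> ab M_gt0; rewrite /node /gridpt /mesh lerDl mulrCA -lerBrDl.
rewrite mulr_ge0 ?divr_ge0 ?subr_ge0 ?ler0n //=.
rewrite ler_piMr ?subr_ge0 // ler_pdivrMr ?ltr0n // mul1r ler_nat.
by rewrite -ltnS.
Qed.

Lemma lt_next {R : realType} {M : nat} {l : nodal R M} {i : 'I_M.+1} :
    (forall j : 'I_M, l (lift ord_max j) < l (lift ord0 j)) -> (i < M)%N ->
  l i < l (Defs.next i).
Proof.
(* As [i < M], there is a half point of index [i], and [inord] in [next i] does not fall back to its
   default. *)
move=> linc iM; have := linc (Ordinal iM).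
rewrite (_ : lift ord_max _ = i); last by apply/val_inj/lift_max.
by rewrite (_ : lift ord0 _ = Defs.next i) //; apply/val_inj; rewrite /= inordK.
Qed.

(** For [0 < i] the truncated predecessor is a true one, so [i] is [next (prev i)] and [lt_next]
    applies at [prev i]. *)
Lemma lt_prev {R : realType} {M : nat} {l : nodal R M} {i : 'I_M.+1} :
    (forall j : 'I_M, l (lift ord_max j) < l (lift ord0 j)) -> (0 < i)%N ->
  l (Defs.prev i) < l i.
Proof.
move=> linc i_gt0; have iM := ltn_ord i.
have prevE : Defs.prev i = i.-1 :> nat.
  by rewrite inordK // (leq_ltn_trans (leq_pred i)).
have nextK : Defs.next (Defs.prev i) = i.
  by apply/val_inj; rewrite /Defs.next prevE prednK //= inordK.
by rewrite -[X in _ < l X]nextK lt_next // prevE prednK // -ltnS.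
Qed.

Lemma tDh_gt0 {R : realType} {M : nat} {h : R} {l : nodal R M} :
    (0 < M)%N -> 0 < h ->
    (forall j : 'I_M, l (lift ord_max j) < l (lift ord0 j)) ->
  forall i, 0 < tDh h l i.
Proof.
move=> M_gt0 h_gt0 linc i; rewrite /tDh.
have [i0|i_neq0] := eqVneq (i : nat) 0%N.
  by rewrite divr_gt0 ?subr_gt0 ?lt_next ?i0.
have [iM|i_neqM] := eqVneq (i : nat) M.
  by rewrite divr_gt0 ?subr_gt0 ?lt_prev ?iM.
(* The centred difference spans two cells, which meet at node [i]. *)
rewrite divr_gt0 ?mulr_gt0 // subr_gt0 (@lt_trans _ _ (l i)) //.
  by rewrite lt_prev ?lt0n.
by rewrite lt_next // ltn_neqAle i_neqM -ltnS ltn_ord.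
Qed.

Lemma mass_eq {R : realType} {a b : R} {M : nat} {u0 : R -> R} {l : nodal R M}
    {i : 'I_M.+1} :
  0 < tDh (mesh a b M) l i -> mass a b u0 l i = mass0 a b u0 i.
Proof.
rewrite /mass /mass0 /density /Defs.interior /tDh => /lt0r_neq0.
have [->|i_neq0] := eqVneq (i : nat) 0%N.
  (* A nonzero quotient has nonzero increment and nonzero mesh, the two side conditions left by
     [field]; the other cases do the same. *)
  rewrite mulf_eq0 invr_eq0 negb_or /= => /andP[? ?].
  by field; apply/andP.
have [->|i_neqM] := eqVneq (i : nat) M.
  rewrite ltnn andbF mulf_eq0 invr_eq0 negb_or => /andP[? ?].
  by field; apply/andP.
rewrite lt0n i_neq0 ltn_neqAle i_neqM -ltnS ltn_ord /=.
rewrite mulf_eq0 invr_eq0 mulf_eq0 !negb_or => /and3P[? _ ?].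
by field; apply/andP.
Qed.

Theorem theorem3p2 (R : realType) (a b : R) (M N : nat) (T : R)
    (u0 H f V Vc Ve W Wc We : R -> R) (x : nat -> nodal R M)
    (hab : a < b) (hM : (0 < M)%N) (hN : (0 < N)%N) (hT : 0 < T)
    (hu0 : forall s, a <= s <= b -> 0 < u0 s)
    (hH : second_derivative_pos H)
    (hf : mobility f)
    (hV : forall s, V s = Vc s - Ve s)
    (hVc : convex_on_line Vc) (hVe : convex_on_line Ve)
    (hW : forall s, W s = Wc s - We s)
    (hWc : convex_on_line Wc) (hWe : convex_on_line We)
    (hWeven : forall s, W (- s) = W s)
    (hWlip : lipschitz W)
    (hx0 : forall i, x 0%N i = node a b M i)
    (hx : forall n, (n < N)%N ->
       admissible a b (x n.+1) /\
       scheme_step a b (T / N%:R) u0 H f Vc Ve Wc We (x n) (x n.+1)) :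
  forall n, (1 <= n <= N)%N ->
    \sum_(i < M.+1) mass a b u0 (x n) i = \sum_(i < M.+1) mass0 a b u0 i
    /\ (forall i : 'I_M.+1, 0 < density a b u0 (x n) i).
Proof.
(* A time index of at least 1 makes the grid the output of a scheme step, hence admissible. *)
move=> [//|n] /andP[_ nN]; have [[xinc _ _] _] := hx _ nN.
have tDx_gt0 := tDh_gt0 hM (mesh_gt0 hab hM) xinc.
split=> [|i]; first by apply: eq_bigr => i _; exact: mass_eq.
by rewrite divr_gt0 ?hu0 ?node_itv ?ltW.
Qed.
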